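(* Let $M$ be a monoid, and let $Q$ be a set of nonzero elements of $M$ such that $\langle Q\rangle$ is factorial and $Q$ is linked to $M$. Then the following conditions are equivalent. (1) $M=\operatorname{Ap}(M,Q)\oplus\langle Q\rangle$. (2) For every $q,q'\in Q$, with $q\neq q'$, we have that $q$ is coprime with $q'$. (3) For every $w,w'\in\operatorname{Ap}(M,Q)$, if $w-w'\in\operatorname{G}(Q)$, then $w=w'$.
   Context: All monoids are additive, commutative, cancellative and reduced (the only unit is $0$). $\mathbb N$ denotes the nonnegative integers. For $a,b\in M$, $a\le_M b$ means $b-a\in M$, that is, $b=a+c$ for some $c\in M$. An atom of a monoid is a nonzero element that is not a sum of two nonzero elements of it. A monoid is factorial if each of its elements can be represented as a linear combination of atoms with uniquely determined coefficients in $\mathbb N$. $\langle Q\rangle$ is the submonoid of $M$ generated by $Q$, and $\operatorname{G}(Q)$ is the subgroup generated by $Q$ inside the quotient group $\operatorname{G}(M)=\{a-b\mid a,b\in M\}$ of $M$. For $X\subseteq M$, the Apéry set of $X$ in $M$ is $\operatorname{Ap}(M,X)=M\setminus(X+M)$. For subsets $X,Y\subseteq M$, $X+Y=\{x+y\mid x\in X,\ y\in Y\}$, and one writes $X\oplus Y$ for $X+Y$ when for every $m\in X+Y$ there exist unique $x\in X$ and $y\in Y$ such that $m=x+y$. A non-empty subset $Q$ of $M$ is linked to $M$ if for each $x\in M\setminus\{0\}$ there exists $c(x)\in\mathbb N$ such that whenever $\sum_{q\in Q}\lambda_q q\le_M x$ for some $\lambda_q\in\mathbb N$ (all but finitely many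 zero), it follows that $\sum_{q\in Q}\lambda_q\le c(x)$. For $x,y\in M$, $x$ is coprime with $y$ if $x\not\le_M y$ and, whenever $x\le_M m+y$ for some $m\in M$, one has $x\le_M m$.
   Formalization: It is additionally assumed that every element of Q is an atom of ⟨Q⟩; without this the claim fails, e.g. for M = ℕ and Q = {1,2}, where (1) and (3) hold but 1 is not coprime with 2. *)

(* Defs.v *)
From HB Require Import structures.
From mathcomp Require Import all_boot all_order all_algebra.
From mathcomp Require Import generic_quotient finmap.
From mathcomp Require Import boolp classical_sets.

Set Implicit Arguments.
Unset Strict Implicit.
Unset Printing Implicit Defensive.

Import GRing.Theory.

Local Open Scope classical_set_scope.
Local Open Scope quotient_scope.
Local Open Scope ring_scope.

HB.mixin Record Nmodule_isCancellative M of GRing.Nmodule M := {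
  cancel_addrI : @right_injective M M M +%R
}.

#[short(type="cancelNmodType")]
HB.structure Definition CancelNmodule :=
  {M of GRing.Nmodule M & Nmodule_isCancellative M}.

Definition reduced (M : nmodType) : Prop :=
  forall u : M, (exists v : M, u + v = 0) -> u = 0.

(* The group of differences G(M): pairs (a, b), standing for a - b, modulo
   (a, b) ~ (c, d) iff a + d = c + b.  Cancellativity gives transitivity. *)
Module QuotientGroup.
Section QuotientGroup.
Variable M : cancelNmodType.
Implicit Types p q : M * M.

Definition equivd p q := p.1 + q.2 == q.1 + p.2.

Lemma equivd_refl : reflexive equivd.
Proof. by move=> p; rewrite /equivd. Qed.

Lemma equivd_sym : symmetric equivd.
Proof. by move=> p q; rewrite /equivd eq_sym. Qed.

Lemma equivd_trans : transitive equivd.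
Proof.
move=> [c d] [a b] [e f]; rewrite /equivd /= => /eqP abcd /eqP cdef.
apply/eqP/(@cancel_addrI M (c + d)).
rewrite [c + d in LHS]addrC addrACA [d + a]addrC abcd cdef.
by rewrite [e + d]addrC addrACA [b + e]addrC.
Qed.

Canonical equivd_equiv := EquivRel equivd equivd_refl equivd_sym equivd_trans.

Definition type := {eq_quot equivd}.

HB.instance Definition _ : EqQuotient _ equivd type := EqQuotient.on type.
HB.instance Definition _ := Choice.on type.

Lemma equivd_repr p :
  p.1 + (repr (\pi_type p)).2 = (repr (\pi_type p)).1 + p.2.
Proof.
by apply/eqP; rewrite -[_ == _]/(equivd p _) -[equivd _ _]eqmodE reprK.
Qed.

Definition zerod : M * M := (0, 0).
Definition addd p q : M * M := (p.1 + q.1, p.2 + q.2).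
Definition oppd p : M * M := (p.2, p.1).

Definition zero : type := \pi zerod.
Definition add := lift_op2 type addd.
Definition opp := lift_op1 type oppd.

Lemma pi_add : {morph \pi : p q / addd p q >-> add p q}.
Proof.
move=> p q; unlock add; apply/eqmodP; rewrite /= /equivd /addd /=.
by rewrite addrACA !equivd_repr addrACA.
Qed.
Canonical pi_add_morph := PiMorph2 pi_add.

Lemma pi_opp : {morph \pi : p / oppd p >-> opp p}.
Proof.
move=> p; unlock opp; apply/eqmodP; rewrite /= /equivd /oppd /=.
by rewrite addrC -equivd_repr addrC.
Qed.
Canonical pi_opp_morph := PiMorph1 pi_opp.

Lemma addA : associative add.
Proof.
elim/quotW=> p; elim/quotW=> q; elim/quotW=> r.
by rewrite -!pi_add /addd /= !addrA.
Qed.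

Lemma addC : commutative add.
Proof.
elim/quotW=> p; elim/quotW=> q.
by rewrite -!pi_add /addd [p.1 + _]addrC [p.2 + _]addrC.
Qed.

Lemma add0 : left_id zero add.
Proof.
by elim/quotW=> -[a b]; rewrite /zero -pi_add /addd /= !add0r.
Qed.

Lemma addN : left_inverse zero opp add.
Proof.
elim/quotW=> p; rewrite /zero -pi_opp -pi_add; apply/eqmodP.
by rewrite /= /equivd /addd /oppd /= addr0 add0r addrC.
Qed.

HB.instance Definition _ := GRing.isZmodule.Build type addA addC add0 addN.

End QuotientGroup.
End QuotientGroup.
HB.export QuotientGroup.

Notation quotgroup := QuotientGroup.type.

Definition to_quotgroup (M : cancelNmodType) (x : M) : quotgroup M :=
  \pi_(quotgroup M) (x, 0).

Lemma to_quotgroup_inj (M : cancelNmodType) : injective (@to_quotgroup M).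
Proof.
by move=> x y /eqmodP /=; rewrite /QuotientGroup.equivd /= !addr0 => /eqP.
Qed.

Lemma to_quotgroupD (M : cancelNmodType) :
  {morph @to_quotgroup M : x y / x + y}.
Proof.
move=> x y; rewrite /to_quotgroup -[RHS]QuotientGroup.pi_add.
by rewrite /QuotientGroup.addd /= addr0.
Qed.

Lemma quotgroupE (M : cancelNmodType) (g : quotgroup M) :
  exists a b : M, g = to_quotgroup a - to_quotgroup b.
Proof.
elim/quotW: g => -[a b]; exists a, b; rewrite /to_quotgroup.
rewrite -[- _]QuotientGroup.pi_opp -[RHS]QuotientGroup.pi_add.
by rewrite /QuotientGroup.addd /= addr0 add0r.
Qed.

Section Monoids.
Variable M : nmodType.
Implicit Types (X Y N Q : set M) (x y a : M).

Definition gen_submonoid Q : set M :=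
  smallest (fun N : set M => GRing.nmod_closed [in N]) Q.

Definition addset X Y : set M := [set x + y | x in X & y in Y].

(* X (+) Y is defined, i.e. every element of X + Y decomposes uniquely. *)
Definition direct X Y : Prop :=
  forall m, addset X Y m ->
    exists! p : M * M, [/\ X p.1, Y p.2 & m = p.1 + p.2].

Definition Apery X : set M := [set: M] `\` addset X [set: M].

Definition lem x y : Prop := exists z : M, y = x + z.

Definition coprime_with x y : Prop :=
  ~ lem x y /\ forall m : M, lem x (m + y) -> lem x m.

Definition atom N a : Prop :=
  [/\ N a, a <> 0 &
      ~ exists x y, [/\ N x, N y, x <> 0, y <> 0 & a = x + y]].

(* Families of natural numbers indexed by M, almost all zero. *)
Definition coefs := {fsfun M -> nat with 0%N}.

Definition supported_in (l : coefs) X : Prop :=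
  forall x, x \in finsupp l -> X x.

Definition lincomb (l : coefs) : M := \sum_(x <- finsupp l) x *+ l x.

Definition coefs_sum (l : coefs) : nat := (\sum_(x <- finsupp l) l x)%N.

Definition factorial_submonoid N : Prop :=
  forall x, N x ->
    exists! l : coefs, supported_in l (atom N) /\ x = lincomb l.

Definition linked Q : Prop :=
  Q !=set0 /\
  forall x, x <> 0 -> exists c : nat, forall l : coefs,
    supported_in l Q -> lem (lincomb l) x -> (coefs_sum l <= c)%N.

End Monoids.

Definition gen_subgroup (G : zmodType) (A : set G) : set G :=
  smallest (fun H : set G => GRing.zmod_closed [in H]) A.

Definition quotgroup_of (M : cancelNmodType) (Q : set M) : set (quotgroup M) :=
  gen_subgroup [set to_quotgroup q | q in Q].

(* Main.v *)
Require Import Defs.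
From mathcomp Require Import all_boot all_order all_algebra.
From mathcomp Require Import finmap.
From mathcomp Require Import boolp classical_sets.

Set Implicit Arguments.
Unset Strict Implicit.
Unset Printing Implicit Defensive.

Import GRing.Theory.

Local Open Scope classical_set_scope.
Local Open Scope ring_scope.

(** Elements of the monoid generated by [Q] are handled as words, that is,
lists of elements of [Q] with their sum.

Linkedness bounds the length of the words that can be split off a given
element; splitting off elements of [Q] one at a time therefore terminates, and
what remains lies in the Apery set.  So [M = Ap(M, Q) + <Q>] always holds
([Apery_decomposition]), and condition (1) only says that the decomposition is
unique.

- (1) implies (2): if [q + z = m + q'], decompose [z] and [m].  Uniqueness
  identifies the Apery parts and leaves an equality [q + s' = s + q'] in [<Q>];
  since [<Q>] is factorial with atoms [Q], the atom [q], being different from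
  [q'], must occur in [s], hence [q] is below [m].
- (2) implies (3): [w - w'] in [G(Q)] means that [w + s = w' + s'] for words
  [s] and [s'].  By coprimality a letter [q] of [s] that does not occur in [s']
  can be pushed through all of [s'] and would be below [w'], which the Apery
  condition forbids; so it occurs in [s'] and can be cancelled
  ([Apery_part_inj]).
- (3) implies (1): two decompositions [w + s = w' + s'] give [w - w'] in
  [G(Q)], so [w = w'], and [s = s'] by cancellation. *)

(** * Words and families of coefficients *)

Section Words.
Variable M : nmodType.
Implicit Types (Q X : set M) (x y z : M) (l : seq M).

Definition word Q l : Prop := forall x, x \in l -> Q x.

Lemma word_nil Q : word Q [::].
Proof. by []. Qed.

Lemma word_cons Q q l : Q q -> word Q l -> word Q (q :: l).
Proof. by move=> Qq Ql x; rewrite inE => /orP[/eqP->//|/Ql]. Qed.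

Lemma word1 Q q : Q q -> word Q [:: q].
Proof. by move=> Qq; apply: word_cons. Qed.

Lemma word_consP Q q l : word Q (q :: l) -> Q q /\ word Q l.
Proof.
move=> Qql; split=> [|x xl]; apply: Qql; first exact: mem_head.
by rewrite inE xl orbT.
Qed.

Lemma word_cat Q l1 l2 : word Q l1 -> word Q l2 -> word Q (l1 ++ l2).
Proof. by move=> Q1 Q2 x; rewrite mem_cat => /orP[/Q1|/Q2]. Qed.

Lemma gen_submonoidP Q x :
  gen_submonoid Q x <-> exists2 l, word Q l & x = \sum_(y <- l) y.
Proof.
split=> [|[l Ql ->{x}]].
  move/(_ [set z | exists2 l, word Q l & z = \sum_(y <- l) y]); apply.
  split; last first.
    move=> q Qq; exists [:: q]; last by rewrite big_seq1.
    exact: word1.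
  split=> [|y z]; first by rewrite inE; exists [::] => //; rewrite big_nil.
  rewrite !inE => -[l1 Q1 ->] [l2 Q2 ->].
  by exists (l1 ++ l2); [exact: word_cat|rewrite big_cat].
move=> N [[N0 ND] QN]; apply: set_mem.
elim: l Ql => [|q l IHl] Ql; first by rewrite big_nil.
have [Qq {}/IHl ?] := word_consP Ql.
by rewrite big_cons; apply: ND => //; exact/mem_set/QN.
Qed.

(** Words are convenient for induction; this translates them into the families
of coefficients in which factoriality and linkedness are expressed. *)
Definition multiplicities l : coefs M :=
  [fsfun x in seq_fset tt l => count_mem x l | 0%N].

Lemma multiplicitiesE l x : multiplicities l x = count_mem x l.
Proof.
by rewrite fsfunE seq_fsetE; case: ifPn => // /count_memPn.
Qed.

Lemma finsupp_multiplicities l x : (x \in finsupp (multiplicities l)) = (x \in l).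
Proof. by rewrite mem_finsupp multiplicitiesE -lt0n -has_count has_pred1. Qed.

Lemma perm_finsupp_multiplicities l :
  perm_eq (finsupp (multiplicities l)) (undup l).
Proof.
apply: uniq_perm; rewrite ?fset_uniq ?undup_uniq// => x.
by rewrite mem_undup; exact: finsupp_multiplicities.
Qed.

Lemma lincomb_multiplicities l : lincomb (multiplicities l) = \sum_(x <- l) x.
Proof.
rewrite /lincomb (perm_big _ (perm_finsupp_multiplicities l)).
rewrite -(big_undup_iterop_count _ l).
by apply: eq_bigr => x _; rewrite multiplicitiesE.
Qed.

Lemma coefs_sum_multiplicities l : coefs_sum (multiplicities l) = size l.
Proof.
rewrite /coefs_sum (perm_big _ (perm_finsupp_multiplicities l)).
rewrite -sum1_size -(big_undup_iterop_count _ l).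
apply: eq_bigr => x _; rewrite multiplicitiesE.
by rewrite Monoid.iteropE iter_addn_0 mul1n.
Qed.

Lemma supported_multiplicities X l :
  word X l -> supported_in (multiplicities l) X.
Proof. by move=> Xl x; rewrite finsupp_multiplicities => /Xl. Qed.

(** The form in which factoriality is used: both words give families of
coefficients on the atoms representing the same element. *)
Lemma factorial_perm_eq Q l1 l2 :
    factorial_submonoid (gen_submonoid Q) ->
    (forall q, Q q -> atom (gen_submonoid Q) q) ->
    word Q l1 -> word Q l2 ->
  \sum_(x <- l1) x = \sum_(x <- l2) x -> perm_eq l1 l2.
Proof.
move=> Qfact Qatom Q1 Q2 eq12.
have [|m [_ m_uniq]] := Qfact (\sum_(x <- l1) x).
  by apply/gen_submonoidP; exists l1.
have m1 : m = multiplicities l1.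
  apply: m_uniq; split; last by rewrite lincomb_multiplicities.
  by apply: supported_multiplicities => x /Q1/Qatom.
have m2 : m = multiplicities l2.
  apply: m_uniq; split; last by rewrite lincomb_multiplicities.
  by apply: supported_multiplicities => x /Q2/Qatom.
by apply/allP => x _ /=; rewrite -!multiplicitiesE -m1 -m2.
Qed.

Lemma linked_size Q x : linked Q -> x <> 0 ->
  exists c, forall l, word Q l -> Defs.lem (\sum_(y <- l) y) x -> (size l <= c)%N.
Proof.
move=> [_ Qlink] /Qlink[c cP]; exists c => l Ql lx.
rewrite -coefs_sum_multiplicities; apply: cP; last by rewrite lincomb_multiplicities.
exact: supported_multiplicities.
Qed.

Lemma lem_sum l x : x \in l -> Defs.lem x (\sum_(y <- l) y).
Proof. by move=> xl; rewrite (big_rem x)//=; eexists. Qed.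

Lemma lem_addl x y z : Defs.lem x y -> Defs.lem x (z + y).
Proof. by move=> [u ->]; exists (z + u); rewrite addrCA. Qed.

End Words.

(** * The Apery set *)

Section Apery.
Variable M : nmodType.
Implicit Types (Q : set M) (x w : M).

Lemma AperyP Q w : Apery Q w <-> forall q, Q q -> ~ Defs.lem q w.
Proof.
split=> [[_ Aw] q Qq [z wE]|Aw]; first by apply: Aw; exists q => //; exists z.
by split=> // -[q Qq [z _ wE]]; apply: (Aw q Qq); exists z.
Qed.

Lemma notin_Apery Q x : ~ Apery Q x -> exists q y, Q q /\ x = q + y.
Proof.
move=> NAx; apply: contrapT => Nx; apply: NAx; apply/AperyP => q Qq [y xE].
by apply: Nx; exists q, y.
Qed.

Lemma Apery0 Q : reduced M -> ~ Q 0 -> Apery Q 0.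
Proof.
move=> Mred Q0; apply/AperyP => q Qq [z qz].
by apply: Q0; rewrite -(Mred q)//; exists z.
Qed.

(** Splitting off one element of [Q] lowers by one the maximal length of a word
below [x], so the splitting stops, and it can only stop in the Apery set. *)
Lemma Apery_decomposition Q x : reduced M -> ~ Q 0 -> linked Q ->
  addset (Apery Q) (gen_submonoid Q) x.
Proof.
move=> Mred Q0 Qlink.
suff [w [l [Aw Ql ->]]] : exists w l,
    [/\ Apery Q w, word Q l & x = w + \sum_(y <- l) y].
  by exists w => //; exists (\sum_(y <- l) y) => //; apply/gen_submonoidP; exists l.
have [->|/eqP/(linked_size Qlink)[c]] := eqVneq x 0.
  exists 0, [::]; split; [exact: Apery0|exact: word_nil|].
  by rewrite big_nil addr0.
elim: c x => [|c IHc] x xc.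
all: have [Ax|/notin_Apery[q [y [Qq xE]]]] := pselect (Apery Q x).
all: try by exists x, [::]; split=> //; rewrite big_nil addr0.
  suff /(xc _ (word1 Qq)) : Defs.lem (\sum_(z <- [:: q]) z) x by [].
  by rewrite big_seq1; exists y.
have [l Ql [z yE]|w [l [Aw Ql yE]]] := IHc y.
  rewrite -ltnS; apply: (xc (q :: l)); first exact: word_cons.
  by exists z; rewrite big_cons xE yE addrA.
by exists w, (q :: l); split; [|exact: word_cons|rewrite big_cons xE yE addrCA].
Qed.

(** Coprimality with each letter strips the letters of [l] off one at a time. *)
Lemma coprime_word q (l : seq M) m :
    (forall q', q' \in l -> coprime_with q q') ->
  Defs.lem q (m + \sum_(y <- l) y) -> Defs.lem q m.
Proof.
elim: l m => [|q' l IHl] m copl; first by rewrite big_nil addr0.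
rewrite big_cons addrA => /IHl qm.
have [_ cop] := copl q' (mem_head _ _); apply/cop/qm => r rl.
by apply: copl; rewrite inE rl orbT.
Qed.

End Apery.

(** * Cancellation and the group of differences *)

Section Cancellative.
Variable M : cancelNmodType.
Implicit Types (Q : set M) (w : M) (l : seq M).

(** Common letters of [l] and [l'] cancel, and any other letter of either word
would have to be below [w] or [w'], so there is none: both words are exhausted by
the cancellation. *)
Lemma Apery_part_inj Q w w' l l' :
    (forall q q', Q q -> Q q' -> q <> q' -> coprime_with q q') ->
    Apery Q w -> Apery Q w' -> word Q l -> word Q l' ->
  w + \sum_(y <- l) y = w' + \sum_(y <- l') y -> w = w'.
Proof.
move=> cop /AperyP Aw /AperyP Aw'.
elim: l l' => [|q l IHl] l' Ql Ql'.
  (* A letter of [l'] would be below [w]. *)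
  rewrite big_nil addr0; case: l' Ql' => [|q' l'] Ql'.
    by rewrite big_nil addr0.
  have [Qq' _] := word_consP Ql'.
  by rewrite big_cons addrCA => wE; case: (Aw q' Qq'); eexists; exact: wE.
have [Qq {}Ql] := word_consP Ql.
have [ql'|ql'] := boolP (q \in l').
  rewrite (big_rem _ ql') big_cons/= !(addrCA _ q) => /cancel_addrI.
  by apply: IHl => // x /mem_rem/Ql'.
(* The letter [q] does not occur in [l'], so it would be below [w']. *)
rewrite big_cons addrCA => wE; case: (Aw' q Qq).
apply: (@coprime_word _ q l'); last by eexists; rewrite -wE.
by move=> q' q'l'; apply: cop => // [|qq']; [exact: Ql'|rewrite qq' q'l' in ql'].
Qed.

(** The differences of two words already form a subgroup, hence all of [G(Q)]. *)
Lemma quotgroup_ofP Q g : quotgroup_of Q g <-> exists l l',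
  [/\ word Q l, word Q l' &
      g = to_quotgroup (\sum_(y <- l) y) - to_quotgroup (\sum_(y <- l') y)].
Proof.
split=> [|[l [l' [Ql Ql' ->]]]].
  move/(_ [set h | exists l l', [/\ word Q l, word Q l' & h =
    to_quotgroup (\sum_(y <- l) y) - to_quotgroup (\sum_(y <- l') y)]]).
  apply; split.
    split=> [|x y].
      rewrite inE; exists [::], [::]; split; try exact: word_nil.
      by rewrite subrr.
    rewrite !inE => -[a [b [Qa Qb ->]]] [c [d [Qc Qd ->]]].
    exists (a ++ d), (b ++ c); split; try exact: word_cat.
    by rewrite !big_cat/= !to_quotgroupD opprB [in RHS]opprD addrACA.
  move=> _ [q Qq <-]; exists [:: q], [::].
  split; [exact: word1|exact: word_nil|].
  by rewrite big_seq1 big_nil subr0.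
move=> H [[H0 HB] QH]; apply: set_mem.
suff Hsum k : word Q k -> to_quotgroup (\sum_(y <- k) y) \in H.
  by apply: HB; exact: Hsum.
have HN u : u \in H -> - u \in H by move=> Hu; rewrite -sub0r; exact: HB.
elim: k => [|q k IHk] Qk; first by rewrite big_nil.
have [Qq {}/IHk Hk] := word_consP Qk.
rewrite big_cons to_quotgroupD -[X in _ + X]opprK; apply: HB; last exact: HN.
by apply/mem_set/QH; exists q.
Qed.

Lemma quotgroup_subP Q w w' :
  quotgroup_of Q (to_quotgroup w - to_quotgroup w') <-> exists l l',
    [/\ word Q l, word Q l' & w + \sum_(y <- l) y = w' + \sum_(y <- l') y].
Proof.
rewrite quotgroup_ofP; split=> -[l [l' [Ql Ql' E]]]; exists l', l; split=> //.
  apply: to_quotgroup_inj; rewrite !to_quotgroupD.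
  by rewrite -[to_quotgroup w](subrK (to_quotgroup w')) E addrAC subrK addrC.
move/(congr1 (@to_quotgroup M)): E; rewrite !to_quotgroupD => E.
apply/eqP; rewrite subr_eq addrAC eq_sym subr_eq E.
by rewrite [X in X == _]addrC.
Qed.

End Cancellative.

(** * The equivalence *)

Theorem theorem22 (M : cancelNmodType) (hM : reduced M)
    (Q : set M) (hQ0 : ~ Q 0)
    (hQfact : factorial_submonoid (gen_submonoid Q))
    (hQatom : forall q, Q q -> atom (gen_submonoid Q) q)
    (hQlinked : linked Q) :
  [<->
    [set: M] = addset (Apery Q) (gen_submonoid Q) /\
      direct (Apery Q) (gen_submonoid Q);
    forall q q' : M, Q q -> Q q' -> q <> q' -> coprime_with q q';
    forall w w' : M, Apery Q w -> Apery Q w' ->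
      quotgroup_of Q (to_quotgroup w - to_quotgroup w') -> w = w'].
Proof.
have decomp x : exists w l,
    [/\ Apery Q w, word Q l & x = w + \sum_(y <- l) y].
  have [w Aw [s /gen_submonoidP[l Ql ->] <-]] :=
    Apery_decomposition x hM hQ0 hQlinked.
  by exists w, l.
tfae.
- move=> [_ dir].
  have uniq w w' l l' : Apery Q w -> Apery Q w' -> word Q l -> word Q l' ->
      w + \sum_(y <- l) y = w' + \sum_(y <- l') y ->
      w = w' /\ perm_eq l l'.
    move=> Aw Aw' Ql Ql' E.
    have Nl : gen_submonoid Q (\sum_(y <- l) y) by apply/gen_submonoidP; exists l.
    have Nl' : gen_submonoid Q (\sum_(y <- l') y) by apply/gen_submonoidP; exists l'.
    have [|p [_ p_uniq]] := dir (w + \sum_(y <- l) y).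
      by exists w => //; exists (\sum_(y <- l) y).
    have pE : p = (w, \sum_(y <- l) y) by exact: p_uniq.
    have : p = (w', \sum_(y <- l') y) by exact: p_uniq.
    rewrite pE => -[-> sE]; split=> //.
    exact: factorial_perm_eq hQfact hQatom Ql Ql' sE.
  have below q q' m : Q q -> Q q' -> q <> q' -> Defs.lem q (m + q') -> Defs.lem q m.
    move=> Qq Qq' /eqP qq' [z mz].
    have [w [l [Aw Ql mE]]] := decomp m.
    have [w' [l' [Aw' Ql' zE]]] := decomp z.
    have [|_ /perm_mem/(_ q)] := uniq w w' (q' :: l) (q :: l') Aw Aw'
      (word_cons Qq' Ql) (word_cons Qq Ql').
      by rewrite !big_cons [LHS]addrCA -mE addrC mz zE addrCA.
    rewrite mem_head inE (negPf qq')/= mE => ql.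
    exact/lem_addl/lem_sum.
  move=> q q' Qq Qq' qq'; split=> [[z q'E]|m]; last exact: below.
  (* [q <= q' = 0 + q'] would give [q <= 0], which is excluded. *)
  have /AperyP/(_ q Qq) := Apery0 hM hQ0; apply.
  by apply: (below q q') => //; exists z; rewrite add0r.
- move=> cop w w' Aw Aw' /quotgroup_subP[l [l' [Ql Ql' E]]].
  exact: Apery_part_inj cop Aw Aw' Ql Ql' E.
- move=> inj; split.
    by apply/esym/seteqP; split=> // x _; exact: Apery_decomposition.
  move=> x [w Aw [s Ns <-]]; exists (w, s); split=> // -[w' s'] /= [Aw' Ns' E].
  have ww' : w = w'.
    apply: inj => //; apply/quotgroup_subP.
    have [l Ql sE] := (gen_submonoidP Q s).1 Ns.
    have [l' Ql' s'E] := (gen_submonoidP Q s').1 Ns'.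
    by exists l, l'; rewrite -sE -s'E.
  by move: E; rewrite ww' => /cancel_addrI->.
Qed.
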